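(* There is a deterministic algorithm for myopic weighted paging with $\ell$ weight classes that is $\ell$-competitive. Moreover, if all page weights lie in the interval $[1,W]$ (with arbitrarily many distinct weight values), then there is a deterministic algorithm for myopic weighted paging that is $O(\log W)$-competitive.
   Context: Weighted paging: there is a universe of pages, each page $p$ has a weight $w_p>0$, and a cache that holds at most $k$ pages. A request sequence $\sigma=(\sigma_1,\sigma_2,\dots)$ of pages arrives; at each time $t$, after serving the request, the cache must contain $\sigma_t$; loading (fetching) a page $p$ into the cache costs $w_p$. The instance has $\ell$ weight classes if the page weights take exactly $\ell$ distinct values $w_1,\dots,w_\ell$; the pages of weight $w_j$ form weight class $j$. Myopic model: when serving the request at time $t$, the algorithm knows $\sigma_1,\dots,\sigma_t$ and, for every pair of pages $p,p'$, which of the two is requested earlier after time $t$ (i.e. the relative order of all pages by the time of their next request), but nothing else about future requests (in particular not how many times a page is requested before another). An algorithm is $c$-competitive if there is a constant $b$ independent of the request sequence such that for every request sequence $\sigma$ its cost is at most $c\cdot \mathrm{OPT}(\sigma)+b$, where $\mathrm{OPT}(\sigma)$ is the minimum cost of any (offline) algorithm serving $\sigma$. *)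

(* Defs.v *)
From HB Require Import structures.
From mathcomp Require Import all_boot all_order all_algebra.
From mathcomp Require Import finmap.
From mathcomp Require Import reals exp.
Set Implicit Arguments. Unset Strict Implicit. Unset Printing Implicit Defensive.
Import Order.TTheory GRing.Theory Num.Theory.
Local Open Scope ring_scope.


Section Paging.
Variables (R : realType) (T : choiceType).

(* A request sequence sigma is indexed from 0: sigma_t = nth _ sigma t.
   A (cache) schedule C : nat -> {fset T} gives the cache content after
   serving request t; the cache before request 0 is empty. *)

Definition prev_cache (C : nat -> {fset T}) (t : nat) : {fset T} :=
  if t is t'.+1 then C t' else fset0.

Definition sched_cost (w : T -> R) (C : nat -> {fset T}) (n : nat) : R :=
  \sum_(t < n) \sum_(p <- (C t `\` prev_cache C t)%fset) w p.

Definition feasible (k : nat) (sigma : seq T) (C : nat -> {fset T}) : Prop :=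
  forall t, (t < size sigma)%N ->
    (#|` C t| <= k)%N /\ (exists x0, nth x0 sigma t \in C t).

(* Myopic information at time t: page p is requested earlier than page q
   after time t (a page never requested again counts as "infinitely late";
   index returns the length of the suffix for absent pages). *)
Definition earlier_after (sigma : seq T) (t : nat) (p q : T) : bool :=
  (index p (drop t.+1 sigma) < index q (drop t.+1 sigma))%N.

(* A deterministic online algorithm: maps the request sequence and the time
   t to the cache after serving request t. *)
Definition online_alg := seq T -> nat -> {fset T}.

Definition myopic_alg (k : nat) (A : online_alg) : Prop :=
  (forall sigma, feasible k sigma (A sigma)) /\
  (forall sigma sigma' t, (t < size sigma)%N -> (t < size sigma')%N ->
     take t.+1 sigma = take t.+1 sigma' ->
     (forall p q, earlier_after sigma t p q = earlier_after sigma' t p q) ->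
     A sigma t = A sigma' t).

(* c-competitiveness: cost <= c * OPT + b for all sigma; since OPT is the
   minimum over feasible offline schedules and c >= 0, this is stated as
   cost <= c * cost(S) + b for every feasible offline schedule S. *)
Definition competitive (k : nat) (w : T -> R) (A : online_alg) (c : R) : Prop :=
  exists b : R, forall (sigma : seq T) (S : nat -> {fset T}),
    feasible k sigma S ->
    sched_cost w (A sigma) (size sigma) <= c * sched_cost w S (size sigma) + b.

Definition weight_classes (w : T -> R) (l : nat) : Prop :=
  exists s : seq R, [/\ uniq s, size s = l,
    (forall p, w p \in s) & (forall x, x \in s -> exists p, w p = x)].

End Paging.

(* Main.v *)
Require Import Defs.
From HB Require Import structures.
From mathcomp Require Import all_boot all_order all_algebra.
From mathcomp Require Import finmap.
From mathcomp Require Import boolp reals sequences exp.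
From mathcomp Require Import zify lra.
Import Order.TTheory GRing.Theory Num.Theory.
Local Open Scope ring_scope.

(** Each weight class [v] carries a credit [c v] in [0, v], initially [v].  On a
  miss with a full cache, all classes present in the cache lose credit at equal
  rate until one of them reaches 0; its credit is then reset, and its page with
  the latest next request is evicted.

  To compare with an offline cache [S], let [E_v] be the maximum over all times
  [m] of the number of class-[v] pages not requested before [m] in the online
  cache minus the same number for [S], truncated at 0.  Only an eviction by [S]
  increases [E_v], by at most 1; serving a request does not.  On a miss with a
  full cache some [E_v] is positive, since [S] holds the requested page and at
  most [k - 1] others.  Hence, with [l] classes, the potential
  [l * \sum_v max(0, v (E_v - 1) + c v)] drops by at least [l] times the amount
  of credit lost per class, which covers the credit lost in all the classes.

  For weights in [[1, W]], rounding down to powers of [e] leaves at most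
  [ln W + 1] classes and changes costs by a factor at most [e]. *)

(** * Splitting big operators over finite sets *)

Lemma big_fset_setID (R : Type) (idx : R) (op : Monoid.com_law idx)
    (T : choiceType) (A B : {fset T}) (F : T -> R) :
  \big[op/idx]_(x <- A) F x =
  op (\big[op/idx]_(x <- (A `&` B)%fset) F x)
     (\big[op/idx]_(x <- (A `\` B)%fset) F x).
Proof.
rewrite (big_fsetID _ (fun x => x \in B)).
congr (op _ _); congr bigop.body; congr enum_fset; apply/fsetP=> x;
  by rewrite !inE // andbC.
Qed.

Lemma big_fset1U (R : Type) (idx : R) (op : Monoid.com_law idx)
    (T : choiceType) (p : T) (A : {fset T}) (F : T -> R) :
  \big[op/idx]_(x <- (p |` A)%fset) F x =
  op (F p) (\big[op/idx]_(x <- (A `\ p)%fset) F x).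
Proof.
rewrite (big_fsetD1 p) ?fset1U1 //; congr (op _ _).
congr bigop.body; congr enum_fset; apply/fsetP=> x.
by rewrite !inE; case: eqP.
Qed.

(** * Excess of the online cache over an offline cache *)

Section Excess.
Context {R : realType} {T : choiceType}.
Variable w : T -> R.
Implicit Types (f : T -> nat) (v : R) (A S : {fset T}).

(** [f x] stands for the time of the next request to [x]. *)
Definition late f v (m : nat) A : nat :=
  (\sum_(x <- A) ((w x == v) && (m <= f x)))%N.

(** This is [E_v], truncated at 0 by natural subtraction. [N] will be the length of the sequence,
    which is also the time assigned to pages never requested again. *)
Definition excess (N : nat) f v A S : nat :=
  (\max_(m < N.+1) (late f v m A - late f v m S))%N.

Lemma excess_leP N f v A S e :
  reflect (forall m, (m <= N)%N -> (late f v m A <= late f v m S + e)%N)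
    (excess N f v A S <= e)%N.
Proof.
rewrite /excess; apply: (iffP (bigmax_leqP _ _ _)) => [H m mN|H m _].
  by have := H (Ordinal (mN : m < N.+1)%N) isT; rewrite /= leq_subLR.
by rewrite leq_subLR H // -ltnS.
Qed.

Lemma late_le_excess N f v A S m : (m <= N)%N ->
  (late f v m A <= late f v m S + excess N f v A S)%N.
Proof. by move: m; apply/excess_leP. Qed.

Lemma lateD1 f v m A q : q \in A ->
  late f v m A = (((w q == v) && (m <= f q)) + late f v m (A `\ q)%fset)%N.
Proof. by move=> qA; rewrite /late (big_fsetD1 q). Qed.

(** Only pages that leave [S] can lower its counts, each by at most 1 at any threshold. *)
Lemma excess_switch N f v A S S' :
  (excess N f v A S' <= excess N f v A S + late f v 0 (S `\` S')%fset)%N.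
Proof.
apply/excess_leP=> m mN.
have := late_le_excess N f v A S m mN.
have -> : late f v m S =
    (late f v m (S `&` S')%fset + late f v m (S `\` S')%fset)%N.
  exact: big_fset_setID.
have -> : late f v m S' =
    (late f v m (S `&` S')%fset + late f v m (S' `\` S)%fset)%N.
  by rewrite fsetIC; exact: big_fset_setID.
have : (late f v m (S `\` S')%fset <= late f v 0 (S `\` S')%fset)%N.
  by apply: leq_sum => x _; case: (w x == v); case: (m <= f x)%N.
lia.
Qed.

Lemma excess_fsetD1 N f v A S q : q \in A ->
  (excess N f v (A `\ q)%fset S <= excess N f v A S)%N.
Proof.
move=> qA; apply/excess_leP=> m mN.
by have := late_le_excess N f v A S m mN; rewrite (lateD1 _ _ _ _ q qA); lia.
Qed.

(** Thresholds up to [f q] count [q] in [A], so its removal gains 1; above [f q] no page of its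
    class in [A] is counted. *)
Lemma excess_evict N f A S q : q \in A ->
    (forall x, x \in A -> w x = w q -> (f x <= f q)%N) ->
  (excess N f (w q) (A `\ q)%fset S <= (excess N f (w q) A S).-1)%N.
Proof.
move=> qA q_last; apply/excess_leP=> m mN.
have := late_le_excess N f (w q) A S m mN.
rewrite (lateD1 _ _ _ _ q qA) eqxx /=.
case: (leqP m (f q)) => [_|fqm] /=; first by lia.
suff -> : late f (w q) m (A `\ q)%fset = 0%N by [].
rewrite /late big_seq big1 // => x; rewrite !inE => /andP[_ xA].
case: eqP => //= /(q_last x xA) fxq.
by rewrite leqNgt (leq_ltn_trans fxq fqm).
Qed.

Lemma excess_eq0 N f v A S : (forall x, x \in A -> w x != v) ->
  excess N f v A S = 0%N.
Proof.
move=> Av; apply/eqP; rewrite -leqn0; apply/excess_leP=> m _.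
rewrite /late big_seq big1 // => x xA; by rewrite (negPf (Av x xA)).
Qed.

(* If [p] is missing from [A], serving it changes the difference of the counts
   only at thresholds [m <= t], where it becomes the old difference at [t.+1]. *)
Lemma excess_serve N f f' v A S p t : p \in S -> (t < N)%N ->
    f p = t -> (t < f' p)%N ->
    (forall x, x != p -> (t < f x)%N /\ f' x = f x) ->
  (excess N f' v (p |` A)%fset S <= excess N f v A S)%N.
Proof.
move=> pS tN fp f'p fE; apply/excess_leP=> m mN.
have lateE B : late f' v m (B `\ p)%fset = late f v m (B `\ p)%fset.
  rewrite /late !big_seq; apply: eq_bigr => x; rewrite !inE => /andP[xp _].
  by rewrite (fE x xp).2.
rewrite (lateD1 _ _ _ _ p pS) lateE.
have -> : late f' v m (p |` A)%fset =
    (((w p == v) && (m <= f' p)) + late f v m (A `\ p)%fset)%N.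
  by rewrite -lateE /late big_fset1U.
have [pA|pA] := boolP (p \in A).
  have := late_le_excess N f v A S m mN.
  by rewrite (lateD1 _ _ _ _ p pA) (lateD1 _ _ _ _ p pS); lia.
rewrite mem_fsetD1 //.
have [mt|tm] := leqP m t; last first.
  have := late_le_excess N f v A S m mN; rewrite (lateD1 _ _ _ _ p pS).
  by rewrite fp [(m <= t)%N]leqNgt tm andbF; lia.
have early B : p \notin B -> late f v m B = late f v t.+1 B.
  move=> pB; rewrite /late !big_seq; apply: eq_bigr => x xB.
  have xp : x != p by apply: contraNneq pB => <-.
  by have := (fE x xp).1; lia.
have := late_le_excess N f v A S t.+1 tN; rewrite (lateD1 _ _ _ _ p pS).
rewrite fp ltnn andbF early // early ?inE ?eqxx //.
by lia.
Qed.

Lemma sum_late (s : seq R) f m A : uniq s -> (forall x, w x \in s) ->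
  (\sum_(v <- s) late f v m A = \sum_(x <- A) (m <= f x))%N.
Proof.
move=> us ws; rewrite /late exchange_big /=; apply: eq_bigr => x _.
rewrite (bigD1_seq (w x)) //= eqxx /= big1 ?addn0 // => v.
by rewrite eq_sym => /negPf->.
Qed.

(** Otherwise, summing over the classes at threshold [t.+1], where all of [A] counts but [p] in [S]
    does not, would make [A] smaller than [S]. *)
Lemma exists_excess (s : seq R) N f A S p t : uniq s -> (forall x, w x \in s) ->
    (t < N)%N -> p \in S -> p \notin A -> (#|` S| <= #|` A|)%N ->
    f p = t -> (forall x, x != p -> (t < f x)%N) ->
  exists2 v, v \in s & (0 < excess N f v A S)%N.
Proof.
move=> us ws tN pS pA SA fp ft; apply/hasP; apply: contraLR SA.
move=> /hasPn noexc; rewrite -ltnNge.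
have : (\sum_(v <- s) late f v t.+1 A <= \sum_(v <- s) late f v t.+1 S)%N.
  rewrite !big_seq; apply: leq_sum => v /noexc; rewrite lt0n negbK => /eqP e0.
  by have := late_le_excess N f v A S t.+1 tN; rewrite e0 addn0.
rewrite !sum_late // (big_fsetD1 p pS) /= fp ltnn add0n (cardfsD1 p S) pS add1n.
rewrite ltnS !card_fset_sum1 => le_sums; apply: leq_trans (leq_trans le_sums _).
  rewrite !big_seq; apply: leq_sum => x xA; rewrite ft //.
  by apply: contraNneq pA => <-.
by apply: leq_sum => x _; case: (_ < _)%N.
Qed.

End Excess.

(** * The credit algorithm and its use of myopic information *)

Section Algorithm.
Context {R : realType} {T : choiceType}.
Variables (w : T -> R) (k : nat).
Implicit Types (e : rel T) (c : R -> R) (A S : {fset T}) (sigma : seq T).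

Definition is_victim e c A q : bool :=
  all (fun x => (c (w q) <= c (w x)) && ((w x == w q) ==> ~~ e q x)) A.

(** Discrete form of the equal-rate decrease: for a victim [q], [c (w q)] is the least credit in the
    cache, hence the amount lost when the first class reaches 0. *)
Definition recharge c A q : R -> R := fun v =>
  if v == w q then v
  else if has (fun x => w x == v) A then c v - c (w q) else c v.

Definition serve e p (st : {fset T} * (R -> R)) : {fset T} * (R -> R) :=
  let: (A, c) := st in
  if (p \in A) || (#|` A| < k)%N then ((p |` A)%fset, c) else
  (* The default [p] is not reached: a nonempty cache has a victim when [e] compares next-request
     times. *)
  let q := nth p A (find (is_victim e c A) A) in
  ((p |` (A `\ q))%fset,
   recharge c A q).

Fixpoint run sigma n : {fset T} * (R -> R) :=
  if n is t.+1 then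
    if drop t sigma is p :: _ then serve (earlier_after sigma t) p (run sigma t)
    else run sigma t
  else (fset0, id).

Definition credit_alg : online_alg T := fun sigma t => (run sigma t.+1).1.

(** Take a page of least credit, then the page of its class with the largest [f]. *)
Lemma exists_victim e (f : T -> nat) c A : A != fset0 ->
    {in A &, forall x y, e x y = (f x < f y)%N} ->
  has (is_victim e c A) A.
Proof.
case/fset0Pn=> a aA eE.
pose a' : A := [` aA]%fset.
have [i _ imin] := @arg_minP _ _ A a' xpredT (fun x => c (w (val x))) isT.
have [j /= /eqP wj jmax] :=
  @arg_maxnP A i (fun x => w (val x) == w (val i)) (fun x => f (val x)) (eqxx _).
apply/hasP; exists (val j); first exact: valP.
apply/allP=> x xA; apply/andP; split; first by rewrite wj (imin [` xA]%fset).
apply/implyP=> wx; rewrite eE ?(valP j) // -leqNgt.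
by apply: (jmax [` xA]%fset); rewrite -wj.
Qed.

(** Being an absolute time, it changes at a step only for the requested page. *)
Definition next sigma t x : nat := (t + index x (drop t sigma))%N.

Lemma next_step sigma t p s x : drop t sigma = p :: s -> x != p ->
  (t < next sigma t x)%N /\ next sigma t.+1 x = next sigma t x.
Proof.
move=> ds xp; rewrite /next -[t.+1]add1n -drop_drop ds /= drop0 eq_sym (negPf xp).
by split; lia.
Qed.

Lemma next_head sigma t p s : drop t sigma = p :: s -> next sigma t p = t.
Proof. by move=> ds; rewrite /next ds /= eqxx addn0. Qed.

Lemma earlier_afterE sigma t p q :
  earlier_after sigma t p q = (next sigma t.+1 p < next sigma t.+1 q)%N.
Proof. by rewrite /earlier_after /next ltn_add2l. Qed.

(** The state at time [t] depends on all earlier comparisons. The order at [t] suffices to recover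
    them: pages requested after [u] and up to [t] are located by the common prefix and precede all
    others. *)
Lemma earlier_after_prefix sigma sigma' u t p q : (u <= t)%N ->
    (t < size sigma)%N -> (t < size sigma')%N ->
    take t.+1 sigma = take t.+1 sigma' ->
    earlier_after sigma t p q = earlier_after sigma' t p q ->
  earlier_after sigma u p q = earlier_after sigma' u p q.
Proof.
move=> ut ts ts' pre; rewrite /earlier_after.
have split_drop (r : seq T) : (t < size r)%N ->
    drop u.+1 r = drop u.+1 (take t.+1 r) ++ drop t.+1 r.
  move=> tr; rewrite -{1}(cat_take_drop t.+1 r) drop_cat size_takel //.
  case: ltnP => // tu; have -> : u = t by apply/eqP; rewrite eqn_leq ut.
  by rewrite subnn drop0 [drop _ (take _ _)]drop_oversize // size_takel.
rewrite (split_drop sigma) // (split_drop sigma') // pre !index_cat.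
set a := drop u.+1 _.
move=> eqe; have [pa|_] := boolP (p \in a); have [qa|_] := boolP (q \in a).
- by [].
- have lt_pa n : (index p a < size a + n)%N by rewrite ltn_addr ?index_mem.
  by rewrite !lt_pa.
- have lt_qa n : (size a + n < index q a)%N = false.
    by apply/negbTE; rewrite -leqNgt ltnW // ltn_addr ?index_mem.
  by rewrite !lt_qa.
- by rewrite !ltn_add2l.
Qed.

Lemma run_myopic sigma sigma' t : (t < size sigma)%N -> (t < size sigma')%N ->
    take t.+1 sigma = take t.+1 sigma' ->
    (forall p q, earlier_after sigma t p q = earlier_after sigma' t p q) ->
  forall u, (u <= t.+1)%N -> run sigma u = run sigma' u.
Proof.
move=> ts ts' pre eqe; elim=> [//|u IH] ut /=; rewrite (IH (ltnW ut)).
have -> : earlier_after sigma u = earlier_after sigma' u.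
  by apply/funext=> p; apply/funext=> q; apply: earlier_after_prefix (eqe p q).
have p0 : T by case: (sigma) ts => [|x s].
rewrite !(drop_nth p0) ?(leq_trans ut) //.
by rewrite -(nth_take p0 ut sigma) -(nth_take p0 ut sigma') pre.
Qed.

Variant serve_spec sigma t p A c : {fset T} * (R -> R) -> Prop :=
| ServeFree of (p \in A) || (#|` A| < k)%N :
    serve_spec sigma t p A c ((p |` A)%fset, c)
| ServeEvict q of p \notin A & (k <= #|` A|)%N & q \in A
    & (forall x, x \in A -> c (w q) <= c (w x))
    & (forall x, x \in A -> w x = w q -> (next sigma t x <= next sigma t q)%N) :
    serve_spec sigma t p A c ((p |` (A `\ q))%fset, recharge c A q).

Lemma serveP sigma t p s A c : (0 < k)%N -> drop t sigma = p :: s ->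
  serve_spec sigma t p A c (serve (earlier_after sigma t) p (A, c)).
Proof.
move=> k0 ds; rewrite /serve; case: ifPn; first by exact: ServeFree.
rewrite negb_or -leqNgt => /andP[pA kA].
have A0 : A != fset0 by rewrite -cardfs_gt0 (leq_trans k0).
have hasv : has (is_victim (earlier_after sigma t) c A) A.
  apply: (exists_victim _ (next sigma t.+1)) => // x y _ _.
  exact: earlier_afterE.
set q := nth _ _ _; have qA : q \in A by rewrite mem_nth // -has_find.
have /allP qv : is_victim (earlier_after sigma t) c A q by apply: nth_find.
apply: ServeEvict => // x /[dup] xA /qv/andP[// _ /implyP q_last wx].
(* Cached pages differ from the missed [p], so their next requests seen from [t] and from [t.+1]
   agree. *)
have neq_p y : y \in A -> y != p by apply: contraTneq => ->.
move: (q_last (introT eqP wx)); rewrite earlier_afterE -leqNgt.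
by rewrite !(next_step _ _ _ _ _ ds _).2 ?neq_p.
Qed.

End Algorithm.

(** * The potential and the amortized cost of one request *)

Section Potential.
Context {R : realType} {T : choiceType}.
Variables (w : T -> R) (k : nat) (s : seq R).
Hypotheses (k_gt0 : (0 < k)%N) (s_uniq : uniq s) (w_s : forall x, w x \in s).
Hypothesis s_ge0 : forall v, v \in s -> 0 <= v.
Implicit Types (f : T -> nat) (c : R -> R) (A S : {fset T}).

Definition weight A : R := \sum_(x <- A) w x.

(* [v - c v] is the part of the next eviction from class [v] already paid for:
   [class_pot] is the weight of the excess when the next page to be evicted
   counts only for its residual credit. *)
Definition class_pot (n : nat) (v cv : R) : R := Num.max 0 (v * n%:R - v + cv).

(** The first sum is the eviction cost already paid by lost credit. The factor [size s] lets the
    decrease of one class cover the credit lost by all. *)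
Definition potential N f A c S : R :=
  \sum_(v <- s) (v - c v) +
  (size s)%:R * \sum_(v <- s) class_pot (excess w N f v A S) v (c v).

Lemma class_pot_ge0 n v cv : 0 <= class_pot n v cv.
Proof. by rewrite /class_pot le_max lexx. Qed.

Lemma class_pot_le n m d v cv : 0 <= v -> (n <= m + d)%N ->
  class_pot n v cv <= class_pot m v cv + v * d%:R.
Proof.
move=> v0; rewrite -(ler_nat R) natrD => nmd.
have := ler_wpM2l v0 nmd; have := mulr_ge0 v0 (ler0n R d); rewrite mulrDr.
rewrite /class_pot !maxEle; case: ifP; case: ifP; lra.
Qed.

Lemma class_pot_homo n m v cv : 0 <= v -> (n <= m)%N ->
  class_pot n v cv <= class_pot m v cv.
Proof.
move=> v0 nm; have := @class_pot_le n m 0%N v cv v0.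
by rewrite addn0 mulr0n mulr0 addr0; apply.
Qed.

Lemma sum_class (F : T -> R) A :
  \sum_(v <- s) \sum_(x <- A) (if w x == v then F x else 0) = \sum_(x <- A) F x.
Proof.
rewrite exchange_big /=; apply: eq_bigr => x _.
rewrite (bigD1_seq (w x)) //= eqxx big1 ?addr0 // => v.
by rewrite eq_sym => /negPf->.
Qed.

Lemma potential_le N f f' A A' c S S' :
    (forall v, (excess w N f' v A' S' <= excess w N f v A S)%N) ->
  potential N f' A' c S' <= potential N f A c S.
Proof.
move=> le_ex; rewrite lerD2l ler_wpM2l // !big_seq ler_sum // => v vs.
exact: class_pot_homo (s_ge0 v vs) (le_ex v).
Qed.

(** Each page that [S] drops raises the excess of its class by at most 1, hence [class_pot] by at
    most its weight. *)
Lemma potential_switch N f A c S S' :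
  potential N f A c S' <=
    potential N f A c S + (size s)%:R * weight (S `\` S')%fset.
Proof.
rewrite /potential -addrA lerD2l -mulrDr ler_wpM2l // /weight -sum_class.
rewrite -big_split !big_seq ler_sum //= => v vs.
have le_ex := excess_switch w N f v A S S'.
apply: le_trans (class_pot_le _ _ _ v (c v) (s_ge0 v vs) le_ex) _.
rewrite lerD2l /late natr_sum mulr_sumr ler_sum // => x _ /=.
by rewrite andbT; case: eqP => [->|_]; rewrite ?mulr1 ?mulr0.
Qed.

Definition valid_credit c := forall v, v \in s -> 0 <= c v <= v.

Lemma recharge_valid c A q : valid_credit c ->
  (forall x, x \in A -> c (w q) <= c (w x)) -> valid_credit (recharge w c A q).
Proof.
move=> vc qmin v vs; rewrite /recharge; case: eqP => [_|_].
  by rewrite s_ge0 /=.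
have /andP[cq0 _] := vc _ (w_s q).
case: hasP => [[x xA /eqP xv]|_]; last exact: vc.
by have := qmin x xA; have := vc v vs; rewrite xv; lra.
Qed.

Lemma potential_evict N f A c S q v0 : valid_credit c -> q \in A ->
    (forall x, x \in A -> c (w q) <= c (w x)) ->
    (forall x, x \in A -> w x = w q -> (f x <= f q)%N) ->
    v0 \in s -> (0 < excess w N f v0 A S)%N ->
  potential N f (A `\ q)%fset (recharge w c A q) S + w q <= potential N f A c S.
Proof.
move=> vc qA qmin qlast v0s ex0.
have /andP[cq0 _] := vc _ (w_s q).
(* Every class loses at most [c (w q)], while the reset of the class of [q] releases [w q]. *)
have spent : \sum_(v <- s) (v - recharge w c A q v) + w q <=
             \sum_(v <- s) (v - c v) + (size s)%:R * c (w q).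
  have -> : (size s)%:R * c (w q) = \sum_(v <- s) c (w q).
    by rewrite big_const_seq count_predT iter_addr_0 mulr_natl.
  have wqE : \sum_(v <- s) (if v == w q then v else 0) = w q.
    by rewrite (bigD1_seq (w q)) //= eqxx big1 ?addr0 // => v /negPf->.
  rewrite -[X in _ + X <= _]wqE.
  rewrite -!big_split !big_seq ler_sum //= => v vs.
  rewrite /recharge; case: eqP => [->|_]; first by lra.
  by case: ifP => _; lra.
have gain : \sum_(v <- s)
        class_pot (excess w N f v (A `\ q)%fset S) v (recharge w c A q v)
      + c (w q) <= \sum_(v <- s) class_pot (excess w N f v A S) v (c v).
  (* Each class of positive excess gives up [c (w q)]; the others do not increase. *)
  have class_gain v : v \in s ->
      class_pot (excess w N f v (A `\ q)%fset S) v (recharge w c A q v) +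
      (if (0 < excess w N f v A S)%N then c (w q) else 0)
      <= class_pot (excess w N f v A S) v (c v).
    move=> vs; have := vc v vs; have := s_ge0 v vs.
    rewrite /recharge; case: eqP => [->|_] v0' /andP[cv0 cv].
      (* The reset adds [w q - c (w q)], but the drop of a positive excess by 1 takes away [w q]. *)
      have := excess_evict w N f A S q qA qlast.
      case: (excess w N f (w q) A S) => [|n] le_ex /=.
        move: le_ex; rewrite leqn0 => /eqP->.
        by rewrite /class_pot mulr0n mulr0 !maxEle; case: ifP; case: ifP; lra.
      apply: (@le_trans _ _ (class_pot n (w q) (w q) + c (w q))).
        by rewrite lerD2r class_pot_homo.
      rewrite /class_pot -natr1 mulrDr mulr1.
      have := mulr_ge0 v0' (ler0n R n).
      rewrite !maxEle; case: ifP; case: ifP; lra.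
    case: hasP => [[x xA /eqP xv]|nA].
      have := qmin x xA; rewrite xv => cqv.
      have := excess_fsetD1 w N f v A S q qA.
      case: (excess w N f v A S) => [|n] le_ex /=.
        move: le_ex; rewrite leqn0 => /eqP->.
        by rewrite /class_pot mulr0n mulr0 !maxEle; case: ifP; case: ifP; lra.
      (* With positive excess the argument of the maximum stays nonnegative after losing [c (w q)],
         so the truncation hides none of the decrease. *)
      apply: (@le_trans _ _ (class_pot n.+1 v (c v - c (w q)) + c (w q))).
        by rewrite lerD2r class_pot_homo.
      rewrite /class_pot -natr1 mulrDr mulr1.
      have := mulr_ge0 v0' (ler0n R n).
      rewrite !maxEle; case: ifP; case: ifP; lra.
    have noA x : x \in A -> w x != v.
      by move=> xA; apply/eqP=> xv; apply: nA; exists x => //; apply/eqP.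
    rewrite !excess_eq0 ?addr0 // => x.
    by rewrite !inE => /andP[_]; exact: noA.
  have cq : c (w q) <= \sum_(v <- s)
      if (0 < excess w N f v A S)%N then c (w q) else 0.
    rewrite (bigD1_seq v0) //= ex0 lerDl sumr_ge0 // => v _.
    by case: ifP.
  apply: le_trans (lerD (lexx _) cq) _.
  by rewrite -big_split !big_seq ler_sum.
have := ler_wpM2l (ler0n R (size s)) gain; rewrite mulrDr.
by move: spent; rewrite /potential; lra.
Qed.

(** Both sides are the weight of the union. *)
Lemma weight_switch A A' :
  weight A' + weight (A `\` A')%fset = weight A + weight (A' `\` A)%fset.
Proof.
rewrite /weight (big_fset_setID _ _ _ _ A' A) (big_fset_setID _ _ _ _ A A') /=.
by rewrite fsetIC; lra.
Qed.

(** Costs are counted at evictions. The offline cache moves to [S'] first, then the algorithm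
    evicts, and last [p] is served, which relies on [p] being in [S']. *)
Lemma potential_step sigma t p r A c S S' : drop t sigma = p :: r ->
    (t < size sigma)%N -> p \in S' -> (#|` S'| <= k)%N -> valid_credit c ->
    (#|` A| <= k)%N ->
  let: (A', c') := serve w k (earlier_after sigma t) p (A, c) in
  [/\ (#|` A'| <= k)%N, valid_credit c' &
    weight (A `\` A')%fset + potential (size sigma) (next sigma t.+1) A' c' S' <=
    potential (size sigma) (next sigma t) A c S
      + (size s)%:R * weight (S `\` S')%fset].
Proof.
move=> ds ts pS' S'k vc Ak.
have nextE x : x != p -> (t < next sigma t x)%N /\ next sigma t.+1 x = next sigma t x.
  exact: next_step ds.
have nextp := next_head _ _ _ _ ds.
have nextp' : (t < next sigma t.+1 p)%N by rewrite /next; lia.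
have := potential_switch (size sigma) (next sigma t) A c S S'.
case: (serveP w k sigma t p r A c k_gt0 ds).
  move=> free switch; split=> //.
    by rewrite cardfsU1; case: (p \in A) free; rewrite //= add1n.
  have -> : (A `\` (p |` A) = fset0)%fset.
    by apply/eqP; rewrite fsetD_eq0 fsubsetU1.
  rewrite /weight big_seq_fset0 add0r; apply: le_trans switch.
  apply: potential_le => v.
by apply: excess_serve pS' ts nextp nextp' nextE.
move=> q pA kA qA qmin qlast switch.
have qp : q != p by apply: contraTneq qA => ->.
split.
- rewrite cardfsU1 !inE (negPf pA) andbF /= add1n.
  by move: Ak; rewrite (cardfsD1 q) qA add1n.
- exact: recharge_valid.
have -> : (A `\` (p |` A `\ q) = [fset q])%fset.
  apply/fsetP=> x; rewrite !inE.
  case: (eqVneq x q) => [->|_] /=; first by rewrite qA (negPf qp).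
  by case: (x \in A); rewrite ?orbT ?andbF.
rewrite /weight big_seq_fset1; apply: le_trans switch.
have le_S'A : (#|` S'| <= #|` A|)%N by exact: leq_trans S'k kA.
have [v0 v0s ex0] := exists_excess w s (size sigma) (next sigma t) A S' p t
  s_uniq w_s ts pS' pA le_S'A nextp (fun x xp => (nextE x xp).1).
apply: le_trans (potential_evict _ _ _ _ _ _ _ vc qA qmin qlast v0s ex0).
rewrite addrC lerD2r; apply: potential_le => v.
by apply: excess_serve pS' ts nextp nextp' nextE.
Qed.

End Potential.

(** * Competitiveness against an offline schedule *)

Section Competitiveness.
Context {R : realType} {T : choiceType}.
Variables (w : T -> R) (k : nat) (s : seq R).
Hypotheses (k_gt0 : (0 < k)%N) (s_uniq : uniq s) (w_s : forall x, w x \in s).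
Hypothesis s_ge0 : forall v, v \in s -> 0 <= v.

Lemma drop_head (sigma : seq T) t : (t < size sigma)%N ->
  exists p, drop t sigma = p :: drop t.+1 sigma /\ forall x, nth x sigma t = p.
Proof.
move=> ts; have p0 : T by case: (sigma) ts => [|x r].
exists (nth p0 sigma t); split; first exact: drop_nth.
by move=> x; exact: set_nth_default.
Qed.

Lemma weight_ge0 (A : {fset T}) : 0 <= weight w A.
Proof. by rewrite sumr_ge0 // => x _; rewrite s_ge0. Qed.

Lemma sched_costS (C : nat -> {fset T}) n :
  sched_cost w C n.+1 =
  sched_cost w C n + weight w (C n `\` prev_cache C n)%fset.
Proof. exact: big_ord_recr. Qed.

Lemma prev_cache_credit sigma t :
  prev_cache (credit_alg w k sigma) t = (run w k sigma t).1.
Proof. by case: t. Qed.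

(** Fetching cost minus the weight in the cache is the weight evicted so far, so the bounds of
    [potential_step] telescope. *)
Lemma credit_alg_invariant sigma (S : nat -> {fset T}) : feasible k sigma S ->
  forall t, (t <= size sigma)%N ->
  let: (A, c) := run w k sigma t in
  [/\ (#|` A| <= k)%N, valid_credit s c &
    sched_cost w (credit_alg w k sigma) t - weight w A
      + potential w s (size sigma) (next sigma t) A c (prev_cache S t)
    <= (size s)%:R * (sched_cost w S t - weight w (prev_cache S t))].
Proof.
move=> feasS; elim=> [_|t IH ts] /=.
  split=> //.
    by move=> v vs; rewrite s_ge0 //= lexx.
  (* Initially credits are full and the excess is 0, so the potential vanishes. *)
  rewrite /sched_cost /weight !big_ord0 !big_seq_fset0 subr0 mulr0 add0r /potential.
  rewrite !big1_seq ?mulr0 ?addr0 // => v /andP[_ vs] /=; last by rewrite subrr.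
  by rewrite excess_eq0 // /class_pot mulr0n mulr0 add0r addNr maxxx.
have [p [ds pE]] := drop_head _ _ ts.
have [S'k [x0]] := feasS t ts; rewrite pE => pS'.
have := IH (ltnW ts); rewrite ds !sched_costS prev_cache_credit.
have -> : credit_alg w k sigma t =
    (serve w k (earlier_after sigma t) p (run w k sigma t)).1.
  by rewrite /credit_alg /= ds.
case: (run w k sigma t) => A c [Ak vc inv].
have := potential_step w k s k_gt0 s_uniq w_s s_ge0 sigma t p _ A c
  (prev_cache S t) (S t) ds ts pS' S'k vc Ak.
case: (serve _ _ _ _ _) => A' c' /= [A'k vc' step]; split=> //=.
(* The evictions of both caches are turned into fetches. *)
have := weight_switch w A A'.
have /(congr1 (fun z => (size s)%:R * z)) := weight_switch w (prev_cache S t) (S t).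
by move: inv step; rewrite !(mulrDr, mulrBr); lra.
Qed.

Lemma potential_ge0 N f A c S : valid_credit s c -> 0 <= potential w s N f A c S.
Proof.
move=> vc; apply: addr_ge0; last first.
  by rewrite mulr_ge0 // sumr_ge0 // => v _; exact: class_pot_ge0.
by rewrite big_seq sumr_ge0 // => v /vc /andP[_ cv]; rewrite subr_ge0.
Qed.

(** The final cache weight is the additive constant, so its bound must not depend on the
    sequence. *)
Lemma weight_le (A : {fset T}) : (#|` A| <= k)%N ->
  weight w A <= k%:R * \sum_(v <- s) v.
Proof.
move=> Ak; apply: (@le_trans _ _ (#|` A|%:R * \sum_(v <- s) v)); last first.
  by rewrite ler_wpM2r ?ler_nat // big_seq sumr_ge0.
rewrite card_fset_sum1 natr_sum mulr_suml ler_sum // => x _.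
rewrite mul1r (bigD1_seq (w x)) //= lerDl big_seq_cond sumr_ge0 // => v /andP[vs _].
exact: s_ge0.
Qed.

Lemma credit_alg_competitive : competitive k w (credit_alg w k) (size s)%:R.
Proof.
exists (k%:R * \sum_(v <- s) v) => sigma S feasS.
have := credit_alg_invariant sigma S feasS (size sigma) (leqnn _).
case: (run w k sigma (size sigma)) => A c [Ak vc inv].
have := weight_le A Ak.
have := potential_ge0 (size sigma) (next sigma (size sigma)) A c
  (prev_cache S (size sigma)) vc.
have := mulr_ge0 (ler0n R (size s)) (weight_ge0 (prev_cache S (size sigma))).
by move: inv; rewrite mulrBr; lra.
Qed.

End Competitiveness.

(** * Feasibility and myopia of the algorithm *)

Section Myopic.
Context {R : realType} {T : choiceType}.
Variables (w : T -> R) (k : nat).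
Hypothesis k_gt0 : (0 < k)%N.

Lemma serve_card (sigma : seq T) t p r A c : drop t sigma = p :: r ->
  (#|` A| <= k)%N ->
  let A' := (serve w k (earlier_after sigma t) p (A, c)).1 in
  (#|` A'| <= k)%N /\ p \in A'.
Proof.
move=> ds Ak; case: (serveP w k sigma t p r A c k_gt0 ds) => /=.
  rewrite fset1U1 cardfsU1 => free; split=> //.
  by case: (p \in A) free; rewrite //= add1n.
move=> q pA _ qA _ _; rewrite fset1U1 cardfsU1 !inE (negPf pA) andbF /= add1n.
by move: Ak; rewrite (cardfsD1 q) qA add1n.
Qed.

Lemma run_card (sigma : seq T) n : (#|` (run w k sigma n).1| <= k)%N.
Proof.
elim: n => [//|t IH] /=.
case ds: (drop t sigma) => [|p r] //.
case: (run w k sigma t) IH => A c /= Ak.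
by have [] := serve_card sigma t p r A c ds Ak.
Qed.

Lemma credit_alg_myopic : myopic_alg k (credit_alg w k).
Proof.
split=> [sigma t ts|sigma sigma' t ts ts' pre eqe]; last first.
  by rewrite /credit_alg (run_myopic w k sigma sigma' t).
have [p [ds pE]] := drop_head sigma t ts.
split; first exact: run_card.
exists p; rewrite pE /credit_alg /= ds; have := run_card sigma t.
case: (run w k sigma t) => A c /= Ak.
by have [] := serve_card sigma t p _ A c ds Ak.
Qed.

End Myopic.

(** * Rounding weights to powers of e *)

Section Rounding.
Context {R : realType} {T : choiceType}.

Lemma sched_cost_ge0 (w : T -> R) C n : (forall p, 0 <= w p) ->
  0 <= sched_cost w C n.
Proof. by move=> w0; rewrite !sumr_ge0 // => t _; rewrite sumr_ge0. Qed.

Lemma sched_cost_le (w w' : T -> R) (d : R) C n : (forall p, w p <= d * w' p) ->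
  sched_cost w C n <= d * sched_cost w' C n.
Proof.
move=> ww'; rewrite /sched_cost mulr_sumr ler_sum // => t _.
by rewrite mulr_sumr ler_sum.
Qed.

(** The cost of [A] grows by a factor at most [d] from [w'] to [w], and the offline schedule costs
    no more under [w'] than under [w]. *)
Lemma competitive_round (k : nat) (w w' : T -> R) A (c d : R) : 0 <= c -> 0 <= d ->
    (forall p, w' p <= w p <= d * w' p) ->
  competitive k w' A c -> competitive k w A (d * c).
Proof.
move=> c0 d0 ww' [b compA]; exists (d * b) => sigma S feasS.
apply: (@le_trans _ _ (d * sched_cost w' (A sigma) (size sigma))).
  by apply: sched_cost_le => p; have /andP[] := ww' p.
rewrite -mulrA -mulrDr ler_wpM2l //; apply: le_trans (compA _ _ feasS) _.
rewrite lerD2r ler_wpM2l // -[leRHS]mul1r; apply: sched_cost_le => p.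
by rewrite mul1r; have /andP[] := ww' p.
Qed.

Lemma competitive_le (k : nat) (w : T -> R) A (c d : R) : (forall p, 0 <= w p) ->
  c <= d -> competitive k w A c -> competitive k w A d.
Proof.
move=> w0 cd [b compA]; exists b => sigma S /compA /le_trans; apply.
by rewrite lerD2r ler_wpM2r // sched_cost_ge0.
Qed.

Lemma expR1_le4 : expR 1 <= 4 :> R.
Proof.
have half : expR (2^-1 : R) <= 2.
  (* [1 + x <= expR x] at -1/2 bounds the inverse of [expR (1/2)] below by 1/2. *)
  have := expR_ge1Dx (- 2^-1 : R); rewrite expRN => h.
  by rewrite -(invrK 2) -lef_pV2 ?posrE ?invr_gt0 ?expR_gt0 // invrK; lra.
have -> : expR (1 : R) = expR 2^-1 * expR 2^-1.
  by rewrite -expRD; congr expR; lra.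
have -> : 4 = 2 * 2 :> R by lra.
by rewrite ler_pM // expR_ge0.
Qed.

Lemma log_competitive (w : T -> R) (k : nat) (W : R) : (0 < k)%N ->
    (forall p, 1 <= w p <= W) ->
  exists A : online_alg T,
    myopic_alg k A /\ competitive k w A (4%:R * (ln W + 1)).
Proof.
move=> k0 wW; pose rounded p : R := expR (Num.truncn (ln (w p)))%:R.
pose classes : seq R := [seq expR i%:R | i <- iota 0 (Num.truncn (ln W)).+1].
exists (credit_alg rounded k); split; first exact: credit_alg_myopic.
(* If [W < 1] there are no pages, so the sequence is empty. *)
have [W1|W1] := leP 1 W; last first.
  exists 0 => -[|p sigma] S _; last by have := wW p; lra.
  by rewrite /sched_cost !big_ord0; lra.
have w0 p : 0 <= w p by have /andP[] := wW p; lra.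
have lnW0 : 0 <= ln W by exact: ln_ge0.
(* The list has [truncn (ln W) + 1] powers, and 4 bounds the rounding factor e. *)
apply: (@competitive_le _ _ _ (4 * (size classes)%:R)) => //.
  rewrite ler_wpM2l // size_map size_iota -natr1 lerD2r.
  by rewrite truncn_le.
apply: (@competitive_round _ w rounded) => // [p|].
  have /andP[w1 _] := wW p; have lnw0 := ln_ge0 w1.
  have /andP[lo hi] := truncn_itv lnw0.
  have wE : w p = expR (ln (w p)) by rewrite lnK // posrE; lra.
  rewrite wE /rounded ler_expR lo /=.
  apply: (@le_trans _ _ (expR (Num.truncn (ln (w p))).+1%:R)).
    by rewrite ler_expR ltW.
  by rewrite -natr1 expRD mulrC ler_wpM2r ?expR_ge0 // expR1_le4.
apply: credit_alg_competitive => //.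
- rewrite map_inj_uniq ?iota_uniq // => i j /expR_inj /eqP.
  by rewrite eqr_nat => /eqP.
- move=> p; apply/mapP; exists (Num.truncn (ln (w p))) => //.
  rewrite mem_iota add0n ltnS /= le_truncn //.
  have /andP[w1 wlW] := wW p; rewrite ler_ln // posrE; lra.
- by move=> v /mapP[i _ ->]; exact: expR_ge0.
Qed.

End Rounding.

(** * The two competitive ratios *)

Theorem theorem1 :
  (forall (R : realType) (T : choiceType) (w : T -> R) (k l : nat),
     (0 < k)%N -> (forall p, 0 < w p) -> weight_classes w l ->
     exists A : online_alg T, myopic_alg k A /\ competitive k w A l%:R)
  /\
  (exists C : nat, forall (R : realType) (T : choiceType) (w : T -> R)
       (k : nat) (W : R),
     (0 < k)%N -> (forall p, 1 <= w p <= W) ->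
     exists A : online_alg T, myopic_alg k A /\
       competitive k w A (C%:R * (ln W + 1))).
Proof.
split; last by exists 4%N => R T w k W; exact: log_competitive.
move=> R T w k l k0 w0 [s [s_uniq <- w_s s_w]].
exists (credit_alg w k); split; first exact: credit_alg_myopic.
apply: credit_alg_competitive => // v /s_w[p <-]; exact: ltW.
Qed.
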